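(* Suppose that $\{x^k\}$ is the sequence generated by the extrapolated hard thresholding algorithm (described in the context) with $\epsilon>0$. Then there exists $x^\infty\in\Omega$ such that $\lim_{k\to\infty}x^k=x^\infty$, and $x^\infty$ is an $\epsilon$-local minimizer (as defined in the context) of the problem $\min_{x\in\Omega}F(x)$.
   Context: Problem: minimize $F(x)=f(x)+\lambda_1\|x_+\|_0+\lambda_2\|x_-\|_0$ over $x\in\Omega$, where $\lambda_1>0$, $\lambda_2\ge 0$, $f:\mathbb{R}^n\to\mathbb{R}$ is a convex function whose gradient is $L_f$-Lipschitz continuous, $\|x_+\|_0$ (resp. $\|x_-\|_0$) is the number of indices $i$ with $x_i>0$ (resp. $x_i<0$), and $\Omega=\{x\in\mathbb{R}^n: l_i\le x_i\le u_i,\ i=1,\dots,n\}$ with $-\infty\le l_i\le 0\le u_i\le+\infty$, $l_i<u_i$. $\|\cdot\|$ is the Euclidean norm, $\|\cdot\|_1$ the $\ell_1$ norm. Extrapolated hard thresholding algorithm: the parameters are $\epsilon\ge 0$, $\beta\ge 0$, $h>0$, $\gamma>0$ with $\gamma\ge \frac1h+(2\beta+h)L_f$; the initial points are $x^{-1}=x^0\in\Omega$. For $k=0,1,2,\dots$ compute $$v^k=\frac{1}{h(1+h\gamma)}(x^k-x^{k-1})-\frac{\beta}{1+h\gamma}\big(\nabla f(x^k)-\nabla f(x^{k-1})\big),\qquad z^k=v^k-\frac{h}{1+h\gamma}\nabla f(x^k),$$ and choose $$x^{k+1}\in x^k+h\cdot\arg\min_{y\in\Omega^k}Q(x^k,z^k,y),$$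 where $\Omega^k=\{y\in\mathbb{R}^n: \frac{l_i-x^k_i}{h}\le y_i\le\frac{u_i-x^k_i}{h},\ i=1,\dots,n\}$ and $$Q(x,z,y)=\frac{h\epsilon}{1+h\gamma}\|y\|_1+\frac{\lambda_1}{1+h\gamma}\|(x+hy)_+\|_0+\frac{\lambda_2}{1+h\gamma}\|(x+hy)_-\|_0+\frac12\|y-z\|^2 .$$ $\epsilon$-local minimizer ($\epsilon>0$): write $\Gamma(x)=\{i: x_i\neq 0\}$, $\Gamma^c(x)$ for its complement in $\{1,\dots,n\}$, $\Omega_i=\{t\in\mathbb{R}: l_i\le t\le u_i\}$, and $\mathcal{N}_C(t)$ for the normal cone of a closed convex set $C\subseteq\mathbb{R}$ at $t\in C$, i.e. $\mathcal{N}_C(t)=\{s\in\mathbb{R}: s(t'-t)\le 0\ \forall t'\in C\}$. - If $\lambda_2>0$: $x^*\in\Omega$ is an $\epsilon$-local minimizer if $0\in[\nabla f(x^* )]_i+\mathcal{N}_{\Omega_i}(x^*_i)+[-\epsilon,\epsilon]$ for all $i\in\Gamma(x^* )$. - If $\lambda_2=0$: $x^*\in\Omega$ is an $\epsilon$-local minimizer if $0\in[\nabla f(x^* )]_i+\mathcal{N}_{[\Omega_{s^*}]_i}(x^*_i)+[-\epsilon,\epsilon]$ for all $i\in\Gamma(x^* )\cup J^*_l$, where $J^*_l=\{j: x^*_j=0 \text{ and } l_j<0\}$, $\Omega_{s^*}=\{x\in\Omega: x_i\le 0\ \forall i\in\Gamma^c(x^* )\}$, and $[\Omega_{s^*}]_i$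 is its $i$-th factor, i.e. $[\Omega_{s^*}]_i=\Omega_i$ if $i\in\Gamma(x^* )$ and $[\Omega_{s^*}]_i=\{t\in\mathbb{R}: l_i\le t\le 0\}$ otherwise.
   Formalization: The formal theorem additionally assumes that F is bounded below on Ω; without it the claim fails, e.g. n=1, f(x)=-2x, Ω=ℝ, λ1=1, λ2=0, ε=h=γ=1, β=0, x^0=1, where the iterates diverge to +∞. *)

(* Defs.v *)
From mathcomp Require Import all_boot all_order all_algebra.
From mathcomp Require Import all_classical all_reals all_analysis.
Import Order.TTheory GRing.Theory Num.Theory.
Import numFieldNormedType.Exports.

Set Implicit Arguments.
Unset Strict Implicit.
Unset Printing Implicit Defensive.

Local Open Scope classical_set_scope.
Local Open Scope ring_scope.

(* The library norm on 'rV[R]_n is the sup norm, hence the explicit Euclidean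
   norm; the two induce the same topology, so that limits and
   differentiability are the library's. *)
Definition norm2 (R : realType) (n : nat) (x : 'rV[R]_n) : R :=
  Num.sqrt (\sum_i x 0 i ^+ 2).

Definition norm1 (R : realType) (n : nat) (x : 'rV[R]_n) : R :=
  \sum_i `|x 0 i|.

Definition pos_l0 (R : realType) (n : nat) (x : 'rV[R]_n) : nat :=
  #|[pred i | 0 < x 0 i]|.

Definition neg_l0 (R : realType) (n : nat) (x : 'rV[R]_n) : nat :=
  #|[pred i | x 0 i < 0]|.

Definition gradient (R : realType) (n : nat) (f : 'rV[R]_n -> R)
    (x : 'rV[R]_n) : 'rV[R]_n :=
  \row_i 'D_(delta_mx 0 i) f x.

Definition lipschitz_gradient (R : realType) (n : nat) (f : 'rV[R]_n -> R)
    (L : R) : Prop :=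
  (forall x, differentiable f x) /\
  forall x y, norm2 (gradient f x - gradient f y) <= L * norm2 (x - y).

Definition box_coord (R : realType) (n : nat) (l u : 'I_n -> \bar R)
    (i : 'I_n) : set R :=
  [set t | (l i <= t%:E <= u i)%E].

Definition box (R : realType) (n : nat) (l u : 'I_n -> \bar R) :
    set 'rV[R]_n :=
  [set x | forall i, box_coord l u i (x 0 i)].

Definition objective (R : realType) (n : nat) (f : 'rV[R]_n -> R)
    (lambda1 lambda2 : R) (x : 'rV[R]_n) : R :=
  f x + lambda1 * (pos_l0 x)%:R + lambda2 * (neg_l0 x)%:R.

(* The infimum of F over Omega is finite. Without this, iterates may diverge:
   n = 1, f(x) = - 2 x, L_f = 0, lambda1 = 1, lambda2 = 0, Omega = R,
   epsilon = h = gamma = 1, beta = 0 and x^0 = 1 give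
   x^(k+1) - x^k = (x^k - x^(k-1)) / 2 + 1 / 2 >= 1 / 2 for all k. *)
Definition bounded_below_on (R : realType) (T : Type) (A : set T)
    (F : T -> R) : Prop :=
  has_lbound (F @` A).

Definition argmin_on (R : realType) (T : Type) (A : set T) (F : T -> R) :
    set T :=
  [set y | A y /\ forall y', A y' -> F y <= F y'].

Definition eht_v (R : realType) (n : nat) (f : 'rV[R]_n -> R)
    (beta h gamma : R) (xprev x : 'rV[R]_n) : 'rV[R]_n :=
  (1 / (h * (1 + h * gamma))) *: (x - xprev)
  - (beta / (1 + h * gamma)) *: (gradient f x - gradient f xprev).

Definition eht_z (R : realType) (n : nat) (f : 'rV[R]_n -> R)
    (beta h gamma : R) (xprev x : 'rV[R]_n) : 'rV[R]_n :=
  eht_v f beta h gamma xprev x - (h / (1 + h * gamma)) *: gradient f x.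

Definition eht_Q (R : realType) (n : nat) (lambda1 lambda2 eps h gamma : R)
    (x z y : 'rV[R]_n) : R :=
  h * eps / (1 + h * gamma) * norm1 y
  + lambda1 / (1 + h * gamma) * (pos_l0 (x + h *: y))%:R
  + lambda2 / (1 + h * gamma) * (neg_l0 (x + h *: y))%:R
  + 1 / 2 * norm2 (y - z) ^+ 2.

(* Infinite bounds stay infinite, since h^-1 > 0 in every use. *)
Definition step_box (R : realType) (n : nat) (l u : 'I_n -> \bar R) (h : R)
    (x : 'rV[R]_n) : set 'rV[R]_n :=
  box (fun i => (l i - (x 0 i)%:E) * (h^-1)%:E)%E
      (fun i => (u i - (x 0 i)%:E) * (h^-1)%:E)%E.

(* The convention x^(-1) = x^0 is encoded by the truncated predecessor:
   0.-1 = 0, so x k.-1 is x^(k-1) for every k. *)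
Definition eht_sequence (R : realType) (n : nat) (f : 'rV[R]_n -> R)
    (lambda1 lambda2 : R) (l u : 'I_n -> \bar R) (eps beta h gamma : R)
    (x : nat -> 'rV[R]_n) : Prop :=
  box l u (x 0%N) /\
  forall k : nat,
    [set x k + h *: y | y in
       argmin_on (step_box l u h (x k))
         (eht_Q lambda1 lambda2 eps h gamma (x k)
            (eht_z f beta h gamma (x k.-1) (x k)))] (x k.+1).

(* Only meant for t in the closed convex set C. *)
Definition normal_cone (R : realType) (C : set R) (t : R) : set R :=
  [set s | forall t', C t' -> s * (t' - t) <= 0].

(* 0 \in g + N_C(t) + [- eps, eps] *)
Definition eps_stationary (R : realType) (eps g : R) (C : set R) (t : R) :
    Prop :=
  [set g + s + e | s in normal_cone C t & e in `[- eps, eps]] 0.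

(* The i-th factor of Omega_s for the reference point x. *)
Definition sbox_coord (R : realType) (n : nat) (l u : 'I_n -> \bar R)
    (x : 'rV[R]_n) (i : 'I_n) : set R :=
  if x 0 i != 0 then box_coord l u i
  else [set t | (l i <= t%:E <= 0)%E].

Definition eps_local_minimizer (R : realType) (n : nat) (f : 'rV[R]_n -> R)
    (lambda2 : R) (l u : 'I_n -> \bar R) (eps : R) (x : 'rV[R]_n) : Prop :=
  [/\ box l u x,
      0 < lambda2 -> forall i, x 0 i != 0 ->
        eps_stationary eps (gradient f x 0 i) (box_coord l u i) (x 0 i)
    & lambda2 = 0 -> forall i, x 0 i != 0 \/ (x 0 i = 0 /\ (l i < 0)%E) ->
        eps_stationary eps (gradient f x 0 i) (sbox_coord l u x i) (x 0 i)].

(* Main.v *)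
Require Import Defs.
From mathcomp Require Import all_boot all_order all_algebra.
From mathcomp Require Import all_classical all_reals all_analysis.
From mathcomp Require Import ring lra.
Import Order.TTheory GRing.Theory Num.Theory.
Import numFieldNormedType.Exports.

(** Write d_k = x^k - x^(k-1). Comparing the minimizer of [eht_Q] with the null
    step, and bounding [f] at the new point by its quadratic upper model
    ([descent]), shows that the energy
      E_k = F(x^k) + a |d_k|^2,   a = 1 / (2 h^2) + beta L_f / (2 h),
    satisfies E_(k+1) + eps |d_(k+1)|_1 <= E_k ([lyapunov_decrease]). The lower
    bound on gamma is exactly what lets the proximal term absorb the two
    extrapolation terms, which are split between |d_k|^2 and |d_(k+1)|^2. As F
    is bounded below on the box, the increments are summable in the l1 norm, so
    the sequence converges ([eht_cvg]); the l1 term, hence eps > 0, is what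
    gives convergence of the whole sequence.

    Stationarity of the limit comes from a first-order condition on the steps
    ([argmin_variational]). Moving coordinate i of x^(k+1) slightly towards a
    feasible t cannot decrease [eht_Q]; if this move increases neither of the
    two counting penalties, they drop out and the first-order part gives
      0 <= eps |t - x^(k+1)_i| + r_k (t - x^(k+1)_i),
    where r_k tends to the i-th partial derivative of f at the limit. The
    penalties are harmless in two situations: if the limit has a nonzero
    coordinate i, since small moves then keep the sign; and if lambda2 = 0 and
    t <= 0, since moving towards a nonpositive value cannot create a positive
    coordinate. The resulting inequality at the limit, for all t in the relevant
    interval, yields the inclusion defining an eps-local minimizer
    ([eps_stationaryP]). *)

Local Open Scope classical_set_scope.
Local Open Scope ring_scope.

(** * Euclidean geometry and the quadratic upper model *)

Definition dot {R : realType} {n : nat} (a b : 'rV[R]_n) : R :=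
  \sum_i a 0 i * b 0 i.

Section Euclidean.
Context {R : realType} {n : nat}.
Implicit Types (a b d x y z : 'rV[R]_n) (s : R).

Lemma dotDl a b d : dot (a + b) d = dot a d + dot b d.
Proof. by rewrite -big_split; apply: eq_bigr => i _; rewrite mxE mulrDl. Qed.

Lemma dotZl s a b : dot (s *: a) b = s * dot a b.
Proof. by rewrite mulr_sumr; apply: eq_bigr => i _; rewrite mxE mulrA. Qed.

Lemma dotC a b : dot a b = dot b a.
Proof. by apply: eq_bigr => i _; rewrite mulrC. Qed.

Lemma dotBl a b d : dot (a - b) d = dot a d - dot b d.
Proof. by rewrite -[- b]scaleN1r dotDl dotZl mulN1r. Qed.

Lemma dotDr a b d : dot d (a + b) = dot d a + dot d b.
Proof. by rewrite dotC dotDl !(dotC d). Qed.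

Lemma dotBr a b d : dot d (a - b) = dot d a - dot d b.
Proof. by rewrite dotC dotBl !(dotC d). Qed.

Lemma dotZr s a b : dot a (s *: b) = s * dot a b.
Proof. by rewrite dotC dotZl dotC. Qed.

Lemma dot_delta a i : dot a (delta_mx 0 i) = a 0 i.
Proof.
rewrite /dot (bigD1 i)//= big1 ?addr0 => [|j ji]; rewrite mxE !eqxx/= ?mulr1//.
by rewrite (negbTE ji) mulr0.
Qed.

Lemma dotxx_ge0 a : 0 <= dot a a.
Proof. by apply: sumr_ge0 => i _; rewrite -expr2 sqr_ge0. Qed.

Lemma norm2_ge0 a : 0 <= norm2 a.
Proof. exact: sqrtr_ge0. Qed.

Lemma sqr_norm2 a : norm2 a ^+ 2 = dot a a.
Proof.
have E : \sum_i a 0 i ^+ 2 = dot a a by apply: eq_bigr => i _; rewrite expr2.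
by rewrite /norm2 E sqr_sqrtr// dotxx_ge0.
Qed.

Lemma norm2Z s a : norm2 (s *: a) = `|s| * norm2 a.
Proof.
rewrite -sqrtr_sqr -sqrtrM ?sqr_ge0// mulr_sumr; congr Num.sqrt.
by apply: eq_bigr => i _; rewrite mxE exprMn.
Qed.

Lemma norm2N a : norm2 (- a) = norm2 a.
Proof. by rewrite -scaleN1r norm2Z normrN1 mul1r. Qed.

Lemma sqr_norm2B a b :
  norm2 (a - b) ^+ 2 = dot a a - 2 * dot a b + dot b b.
Proof. by rewrite sqr_norm2 dotBl !dotBr (dotC b a); ring. Qed.

Lemma coord_le_norm2 a i : `|a 0 i| <= norm2 a.
Proof.
rewrite -sqrtr_sqr; apply: ler_wsqrtr.
by rewrite (bigD1 i)//= lerDl; apply: sumr_ge0 => j _; rewrite sqr_ge0.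
Qed.

Lemma coord_le_norm1 a i : `|a 0 i| <= norm1 a.
Proof. by rewrite /norm1 (bigD1 i)//= lerDl; apply: sumr_ge0. Qed.

(** Cauchy-Schwarz, from the nonnegativity of the square of
    [norm2 b *: a - norm2 a *: b]. *)
Lemma dot_le_norm2 a b : dot a b <= norm2 a * norm2 b.
Proof.
have [a0|a0] := eqVneq (norm2 a) 0; last have [b0|b0] := eqVneq (norm2 b) 0.
- rewrite a0 mul0r /dot big1// => i _.
  have := coord_le_norm2 a i; rewrite a0 normr_le0 => /eqP ->.
  by rewrite mul0r.
- rewrite b0 mulr0 /dot big1// => i _.
  have := coord_le_norm2 b i; rewrite b0 normr_le0 => /eqP ->.
  by rewrite mulr0.
have ab : 0 < norm2 a * norm2 b by rewrite mulr_gt0// lt_def norm2_ge0 ?a0 ?b0.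
rewrite -(ler_pM2l ab).
have := dotxx_ge0 (norm2 b *: a - norm2 a *: b).
rewrite !(dotBl, dotBr, dotZl, dotZr) -!sqr_norm2 (dotC b a).
by move=> H; nra.
Qed.

Lemma gradientE (f : 'rV[R]_n -> R) x d :
  differentiable f x -> 'd f x d = dot (gradient f x) d.
Proof.
move=> fx; rewrite {1}[d]row_sum_delta linear_sum; apply: eq_bigr => i _.
by rewrite linearZ/= -deriveE// mxE mulrC.
Qed.

Lemma is_derive_along (f : 'rV[R]_n -> R) x d s :
  (forall y, differentiable f y) ->
  is_derive s 1 (fun t : R => f (x + t *: d)) (dot (gradient f (x + s *: d)) d).
Proof.
move=> fdiff.
have dline : is_diff s (cst x + (fun t : R => t *: d)) (0 + ( *:%R^~ d)).
  apply: is_diffD.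
have dg : differentiable (fun t : R => f (x + t *: d)) s.
  by apply: differentiable_comp.
apply: DeriveDef; first exact/derivable1_diffP.
rewrite deriveE//.
have -> : (fun t : R => f (x + t *: d)) = f \o (cst x + (fun t : R => t *: d)).
  by [].
rewrite diff_comp//= diff_val gradientE//=.
by rewrite add0r scale1r.
Qed.

(** Along the segment from [x] to [x + d], the difference between [f] and its
    quadratic upper model has a nonpositive derivative, so it stays nonpositive
    by the mean value theorem. *)
Lemma descent (f : 'rV[R]_n -> R) L x d : lipschitz_gradient f L ->
  f (x + d) <= f x + dot (gradient f x) d + L / 2 * norm2 d ^+ 2.
Proof.
move=> [fdiff fL].
pose g := dot (gradient f x) d; pose q := L * norm2 d ^+ 2.
pose phi (t : R) := f (x + t *: d) - (t * g + t ^+ 2 * (q / 2)).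
pose dphi (t : R) := dot (gradient f (x + t *: d)) d - (g + t * q).
have phi' (t : R) : is_derive t 1 phi (dphi t).
  apply: is_deriveB; first exact: is_derive_along.
  apply: is_derive_eq.
  by rewrite /GRing.scale/=; field.
have [|c c01] := @MVT_segment R phi dphi 0 1 ler01.
  by apply: derivable_within_continuous => t _; exact: ex_derive.
have c0 : 0 <= c by move: c01; rewrite in_itv/= => /andP[].
rewrite subr0 mulr1 /phi scale1r scale0r addr0 => E.
suff : dphi c <= 0 by rewrite -/g; move: E; rewrite /q; lra.
rewrite /dphi /g opprD addrA -dotBl subr_le0.
apply: le_trans (dot_le_norm2 _ _) _.
have := fL (x + c *: d) x.
rewrite addrAC subrr add0r norm2Z ger0_norm// => H.
have := ler_wpM2r (norm2_ge0 d) H; rewrite /q; lra.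
Qed.

(** The constant itself may be negative, but only in dimension zero. *)
Lemma lipschitz_norm_ge0 (f : 'rV[R]_n -> R) L x :
  lipschitz_gradient f L -> 0 <= L * norm2 x.
Proof.
by move=> [_ /(_ x 0)]; rewrite subr0; apply: le_trans; exact: norm2_ge0.
Qed.

End Euclidean.

(** * Stationarity intervals, boxes and sign counts *)

Section StationarityAndBoxes.
Context {R : realType} {n : nat}.
Implicit Types (l u : 'I_n -> \bar R) (x y z : 'rV[R]_n).

(** The element [e] of the error interval is the projection of [- g] on
    [[- eps, eps]]; when [g] lies outside, the hypothesis forces [t] to be the
    endpoint of [C] towards which [- g] points. *)
Lemma eps_stationaryP (eps g : R) (C : set R) (t : R) : 0 <= eps ->
  (forall t', C t' -> 0 <= eps * `|t' - t| + g * (t' - t)) ->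
  eps_stationary eps g C t.
Proof.
move=> eps0 H.
suff [e [/andP[e1 e2] He]] : exists e, - eps <= e <= eps /\
    (forall t', C t' -> 0 <= (g + e) * (t' - t)).
  exists (- (g + e)).
    by move=> t' /He; rewrite mulNr oppr_le0.
  by exists e; [rewrite /= in_itv/= e1 e2|ring].
have [gl|gl] := ltP g (- eps).
  exists eps; split; first by apply/andP; split; lra.
  move=> t' /H; have [d0|d0] := leP 0 (t' - t).
    by rewrite ger0_norm//; lra.
  by move=> _; nra.
have [gu|gu] := ltP eps g.
  exists (- eps); split; first by apply/andP; split; lra.
  move=> t' /H; have [d0|d0] := leP 0 (t' - t).
    by move=> _; nra.
  by rewrite ltr0_norm//; lra.
exists (- g); split; first by apply/andP; split; lra.
by move=> t' _; rewrite subrr mul0r.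
Qed.

Lemma step_boxE l u h x y : 0 < h ->
  step_box l u h x y <-> box l u (x + h *: y).
Proof.
move=> h0; split=> H i; move: (H i); rewrite /box_coord/= !mxE.
  rewrite !EFinN lee_pdivrMr// lee_pdivlMr// leeBlDr// leeBrDr//.
  by rewrite -EFinM -EFinD mulrC addrC.
rewrite !EFinN lee_pdivrMr// lee_pdivlMr// leeBlDr// leeBrDr//.
by rewrite -EFinM -EFinD mulrC addrC.
Qed.

Lemma box_coord_segment l u i (a b s : R) : 0 <= s <= 1 ->
  box_coord l u i a -> box_coord l u i b -> box_coord l u i (a + s * (b - a)).
Proof.
move=> /andP[s0 s1] /andP[la au] /andP[lb bu]; apply/andP; split.
- have [ab|ba] := leP a b.
    by apply: (le_trans la); rewrite lee_fin; nra.
  by apply: (le_trans lb); rewrite lee_fin; nra.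
- have [ab|ba] := leP a b.
    by apply: le_trans bu; rewrite lee_fin; nra.
  by apply: le_trans au; rewrite lee_fin; nra.
Qed.

Lemma pos_l0_le x y : (forall i, 0 < x 0 i -> 0 < y 0 i) ->
  (pos_l0 x <= pos_l0 y)%N.
Proof. by move=> H; apply/subset_leq_card/fintype.subsetP => i; exact: H. Qed.

Lemma neg_l0_le x y : (forall i, x 0 i < 0 -> y 0 i < 0) ->
  (neg_l0 x <= neg_l0 y)%N.
Proof. by move=> H; apply/subset_leq_card/fintype.subsetP => i; exact: H. Qed.

End StationarityAndBoxes.

(** * One step of the algorithm *)

Section OneStep.
Context {R : realType} {n : nat}.
Implicit Types (l u : 'I_n -> \bar R) (x y z w : 'rV[R]_n).

Lemma norm1D_delta y i (s : R) :
  norm1 (y + s *: delta_mx 0 i) <= norm1 y + `|s|.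
Proof.
rewrite /norm1 (bigD1 i)//= [in leRHS](bigD1 i)//= !mxE !eqxx mulr1 addrAC.
apply: lerD; first exact: ler_normD.
apply: ler_sum => j ji; rewrite !mxE eqxx/= (negbTE ji) mulr0 addr0//.
Qed.

Lemma ge0_small_perturbation (A B s0 : R) : 0 < s0 ->
  (forall s, 0 < s <= s0 -> 0 <= A + s * B) -> 0 <= A.
Proof.
move=> s00 H; rewrite leNgt; apply/negP => A0.
have B0 : 0 < B by have := H s0; rewrite s00 lexx => /(_ isT); nra.
have AB : 0 < - A / (2 * B) by rewrite divr_gt0 ?oppr_gt0 ?mulr_gt0.
have [sle|slt] := leP s0 (- A / (2 * B)).
  have := H s0; rewrite s00 lexx => /(_ isT).
  by move: sle; rewrite ler_pdivlMr ?mulr_gt0//; nra.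
have := H (- A / (2 * B)); rewrite AB (ltW slt) => /(_ isT).
have -> : - A / (2 * B) * B = - A / 2 by field; rewrite gt_eqF.
lra.
Qed.

(** The comparison point is [x + h *: y] with coordinate [i] moved by a fraction
    [s] of the way to [t]. The two sign hypotheses say that this move increases
    neither counting penalty; dividing by [s] and letting [s] tend to 0 removes
    the second-order part of the quadratic term. *)
Lemma argmin_variational l u (lambda1 lambda2 eps h gamma t s0 : R) x z y i :
  let w := (x + h *: y) 0 i in
  0 <= lambda1 -> 0 <= lambda2 -> 0 <= eps -> 0 < h -> 0 < gamma ->
  argmin_on (step_box l u h x) (eht_Q lambda1 lambda2 eps h gamma x z) y ->
  box_coord l u i t -> 0 < s0 <= 1 ->
  (forall s, 0 < s <= s0 -> 0 < w + s * (t - w) -> 0 < w) ->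
  (forall s, 0 < s <= s0 -> 0 < lambda2 -> w + s * (t - w) < 0 -> w < 0) ->
  0 <= eps * `|t - w| + (1 + h * gamma) / h * (y 0 i - z 0 i) * (t - w).
Proof.
move=> w l1 l2 e0 h0 g0 [yB ymin] tB /andP[s00 s01] posw negw.
have c0 : 0 < 1 + h * gamma by rewrite addr_gt0// mulr_gt0.
set c := 1 + h * gamma in c0 *.
move: yB => /(step_boxE _ _ _ _ _ h0) yB.
apply: (@ge0_small_perturbation _ (c / (2 * h ^+ 2) * (t - w) ^+ 2) s0) => //.
move=> s /[dup] ss0 /andP[s0' ss].
pose delta := s * (t - w) / h.
pose y' := y + delta *: delta_mx 0 i.
have wE j : (x + h *: y') 0 j = if j == i then w + s * (t - w)
                                else (x + h *: y) 0 j.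
  rewrite !mxE eqxx/=; case: eqVneq => [->|_] /=; last by rewrite mulr0 addr0.
  by rewrite /delta /w !mxE mulr1; field; rewrite gt_eqF.
have y'B : step_box l u h x y'.
  apply/step_boxE => // j; rewrite wE; case: eqVneq => [->|_].
    apply: box_coord_segment; [|exact: yB|exact: tB].
    by rewrite (ltW s0') (le_trans ss).
  exact: yB.
have posl : lambda1 / c * (pos_l0 (x + h *: y'))%:R <=
            lambda1 / c * (pos_l0 (x + h *: y))%:R.
  apply: ler_wpM2l; first by rewrite divr_ge0// ltW.
  rewrite ler_nat; apply: pos_l0_le => j; rewrite wE.
  by case: eqVneq => [->|//]; exact: posw.
have negl : lambda2 / c * (neg_l0 (x + h *: y'))%:R <=
            lambda2 / c * (neg_l0 (x + h *: y))%:R.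
  move: l2; rewrite le_eqVlt => /predU1P[<-|l2]; first by rewrite !mul0r.
  apply: ler_wpM2l; first by rewrite divr_ge0// ltW.
  rewrite ler_nat; apply: neg_l0_le => j; rewrite wE.
  by case: eqVneq => [->|//]; exact: negw.
have n1 : h * eps / c * norm1 y' <= h * eps / c * (norm1 y + `|delta|).
  apply: ler_wpM2l; last exact: norm1D_delta.
  by rewrite divr_ge0 ?mulr_ge0// ltW.
have n2 : norm2 (y' - z) ^+ 2 =
    norm2 (y - z) ^+ 2 + 2 * delta * (y 0 i - z 0 i) + delta ^+ 2.
  have -> : y 0 i - z 0 i = (y - z) 0 i by rewrite !mxE.
  have -> : y' - z = (y - z) + delta *: delta_mx 0 i by rewrite /y' addrAC.
  rewrite !sqr_norm2; move: (y - z) => v.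
  rewrite dotDl !dotDr !dotZl !dotZr (dotC (delta_mx _ _) v) !dot_delta.
  by rewrite mxE !eqxx/=; ring.
have := ymin _ y'B; rewrite /eht_Q -/c n2 => Q.
have key : 0 <= h * eps / c * `|delta| + delta * (y 0 i - z 0 i)
                + delta ^+ 2 / 2.
  lra.
have dE : `|delta| = s * `|t - w| / h.
  by rewrite /delta !normrM (gtr0_norm s0') normfV (gtr0_norm h0).
have cs : 0 < s / c by rewrite divr_gt0.
rewrite -(pmulr_rge0 _ cs).
rewrite (_ : s / c * _ = h * eps / c * `|delta| + delta * (y 0 i - z 0 i)
                + delta ^+ 2 / 2)//.
by rewrite dE /delta; field; rewrite !gt_eqF.
Qed.

(** The comparison point is the null step, whose counting penalties are those of
    [x]. The two extrapolation terms are split evenly between the previous and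
    the new increment, whence the same coefficient [a] on both sides. *)
Lemma lyapunov_decrease (f : 'rV[R]_n -> R) l u
    (L lambda1 lambda2 eps beta h gamma : R) xp x y :
  let a := 1 / (2 * h ^+ 2) + beta * L / (2 * h) in
  let F := objective f lambda1 lambda2 in
  lipschitz_gradient f L -> 0 <= beta -> 0 < h -> 0 < gamma ->
  1 / h + (2 * beta + h) * L <= gamma -> box l u x ->
  argmin_on (step_box l u h x)
    (eht_Q lambda1 lambda2 eps h gamma x (eht_z f beta h gamma xp x)) y ->
  F (x + h *: y) + a * norm2 (h *: y) ^+ 2 + eps * norm1 (h *: y)
    <= F x + a * norm2 (x - xp) ^+ 2.
Proof.
move=> a F fL b0 h0 g0 gam xB [yB ymin].
set z := eht_z _ _ _ _ _ _ in ymin.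
have c0 : 0 < 1 + h * gamma by rewrite addr_gt0// mulr_gt0.
set c := 1 + h * gamma in c0.
have B0 : step_box l u h x 0 by apply/step_boxE; rewrite // scaler0 addr0.
have := ymin _ B0; rewrite /eht_Q -/c scaler0 addr0 sub0r.
have -> : norm1 (0 : 'rV[R]_n) = 0.
  by rewrite /norm1 big1// => i _; rewrite mxE normr0.
rewrite sqr_norm2B norm2N sqr_norm2 => Q.
set d := x - xp; set g := gradient f x; set dg := g - gradient f xp.
have yz : c * dot y z = dot y d / h - beta * dot y dg - h * dot y g.
  rewrite /z /eht_z /eht_v -/c -/d -/g -/dg.
  move: (d) (dg) (g) => v1 v2 v3; rewrite !dotBr !dotZr.
  by field; rewrite !gt_eqF.
(* The comparison with the null step, multiplied by [c]. *)
have Q' : h * eps * norm1 y + lambda1 * (pos_l0 (x + h *: y))%:R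
    + lambda2 * (neg_l0 (x + h *: y))%:R + c / 2 * dot y y - c * dot y z
    <= lambda1 * (pos_l0 x)%:R + lambda2 * (neg_l0 x)%:R.
  rewrite -subr_ge0 in Q; rewrite -subr_ge0.
  have := mulr_ge0 (ltW c0) Q; congr (0 <= _).
  by field; rewrite gt_eqF.
have hy2 : norm2 (h *: y) ^+ 2 = h ^+ 2 * dot y y.
  by rewrite sqr_norm2 dotZl dotZr mulrA -expr2.
have D := descent f L x (h *: y) fL; rewrite -/g dotZr hy2 (dotC g) in D.
(* Young's inequality for the inertial term and for the gradient correction. *)
have Y1 : dot y d / h <= dot d d / (2 * h ^+ 2) + dot y y / 2.
  have := sqr_ge0 (norm2 (h *: y - d)).
  rewrite sqr_norm2B !(dotZl, dotZr) => H.
  rewrite -subr_ge0.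
  have hh : 0 <= 1 / (2 * h ^+ 2) by rewrite divr_ge0// mulr_ge0// sqr_ge0.
  have := mulr_ge0 hh H; congr (0 <= _).
  by field; rewrite gt_eqF.
have Y2 : - dot y dg <= L / 2 * (dot d d / h + h * dot y y).
  have -> : - dot y dg = dot (-1 *: y) dg by rewrite dotZl mulN1r.
  apply: le_trans (dot_le_norm2 _ _) _.
  rewrite norm2Z normrN1 mul1r.
  have H1 : norm2 y * norm2 dg <= norm2 y * (L * norm2 d).
    by apply: ler_wpM2l; [exact: norm2_ge0 | exact: fL.2].
  apply: le_trans H1 _; rewrite -!sqr_norm2.
  have : 0 <= L * (norm2 d - h * norm2 y) ^+ 2 / (2 * h).
    apply: divr_ge0; last by rewrite mulr_ge0// ltW.
    have [L0|L0] := leP 0 L; first by rewrite mulr_ge0// sqr_ge0.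
    (* A negative Lipschitz constant forces every norm to vanish. *)
    have z0 (v : 'rV[R]_n) : norm2 v = 0.
      have := lipschitz_norm_ge0 f L v fL; rewrite nmulr_rge0// => v0.
      by apply/eqP; rewrite eq_le v0 norm2_ge0.
    by rewrite !z0 mulr0 subrr expr0n mulr0.
  rewrite -subr_ge0 => H; rewrite -subr_ge0; move: H; congr (0 <= _).
  by field; rewrite gt_eqF.
have Y2' := ler_wpM2l b0 Y2.
have n1 : norm1 (h *: y) = h * norm1 y.
  rewrite /norm1 mulr_sumr; apply: eq_bigr => i _.
  by rewrite mxE normrM gtr0_norm.
have cge : 2 + (2 * beta * h + h ^+ 2) * L <= c.
  have := ler_wpM2l (ltW h0) gam; rewrite /c => H.
  have E : h * (1 / h + (2 * beta + h) * L) = 1 + (2 * beta * h + h ^+ 2) * L.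
    by field; rewrite gt_eqF.
  by move: H; rewrite E; lra.
have cy := ler_wpM2r (dotxx_ge0 y) cge.
rewrite hy2 n1 sqr_norm2 -/d /F /objective.
have -> : a * (h ^+ 2 * dot y y) = (1 / 2 + beta * L * h / 2) * dot y y.
  by rewrite /a; field; rewrite gt_eqF.
have -> : a * dot d d = dot d d / (2 * h ^+ 2) + beta * (L / 2 * (dot d d / h)).
  by rewrite /a; field; rewrite gt_eqF.
move: Q' D Y1 Y2' cy; rewrite yz.
move: (norm1 y) (dot y y) (dot d d) => N yy dd.
nra.
Qed.

End OneStep.

(** * Limits *)

Section Limits.
Context {R : realType}.

Lemma small_step_keeps_sign (p t : R) : p != 0 ->
  exists2 s0 : R, 0 < s0 <= 1 & forall s, 0 < s <= s0 ->
    (0 < p + s * (t - p) -> 0 < p) /\ (p + s * (t - p) < 0 -> p < 0).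
Proof.
move=> p0; have np : 0 < `|p| by rewrite normr_gt0.
have nt : 0 <= `|t - p| by exact: normr_ge0.
have q0 : 0 < `|p| + `|t - p| by lra.
(* With this bound the move is shorter than [`|p|]. *)
exists (`|p| / (`|p| + `|t - p|)).
  by rewrite divr_gt0//= ler_pdivrMr// mul1r lerDl.
move=> s /andP[s0]; rewrite ler_pdivlMr// => ss.
have : `|s * (t - p)| < `|p| by rewrite normrM (gtr0_norm s0); nra.
rewrite ltr_norml => /andP[]; have [pn|pp] := leP p 0.
  by rewrite ler0_norm//; split; lra.
by rewrite gtr0_norm//; split; lra.
Qed.

Context {n : nat}.

(** A sequence whose increments are dominated by the decrements of a bounded
    below sequence converges: [a = (a - e) + e], where [e] is nonincreasing,
    [a - e] is nondecreasing, and [a + e] being nonincreasing bounds the latter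
    from above. *)
Lemma cvgn_increments (a e : nat -> R) (m : R) :
  (forall k, `|a k.+1 - a k| <= e k - e k.+1) -> (forall k, m <= e k) ->
  cvgn a.
Proof.
move=> ae em.
have e_cvg : cvgn e.
  apply: nonincreasing_is_cvgn.
    apply/nonincreasing_seqP => k; rewrite -subr_ge0.
    exact: le_trans (normr_ge0 _) (ae k).
  by exists m => _ [k _ <-]; exact: em.
have ub k : a k + e k <= a 0 + e 0.
  elim: k => // k; apply: le_trans.
  by have := ae k; rewrite ler_norml => /andP[_]; lra.
have ae_cvg : cvgn (a \- e).
  apply: nondecreasing_is_cvgn.
    apply/nondecreasing_seqP => k /=.
    by have := ae k; rewrite ler_norml => /andP[+ _]; lra.
  exists (a 0 + e 0 - 2 * m) => _ [k _ <-] /=.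
  by have := ub k; have := em k; lra.
have -> : a = (a \- e) \+ e by apply/funext => k /=; rewrite subrK.
exact: is_cvgD.
Qed.

Lemma cvg_row (x : nat -> 'rV[R]_n) (xl : 'rV[R]_n) :
  (forall i, x k 0 i @[k --> \oo] --> xl 0 i) -> x k @[k --> \oo] --> xl.
Proof.
move=> H; rewrite [xl]row_sum_delta.
under eq_fun do rewrite [x _]row_sum_delta.
apply: cvg_big => [|i _]; first exact: add_continuous.
by apply: cvgZr_tmp; exact: H.
Qed.

Lemma cvg_coord (x : nat -> 'rV[R]_n) (xl : 'rV[R]_n) i :
  x k @[k --> \oo] --> xl -> x k 0 i @[k --> \oo] --> xl 0 i.
Proof.
by move=> H; exact: (continuous_cvg _ (@coord_continuous R 1 n 0 i xl) H).
Qed.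

Lemma norm2_cvg0 (x : nat -> 'rV[R]_n) (xl : 'rV[R]_n) :
  x k @[k --> \oo] --> xl -> norm2 (x k - xl) @[k --> \oo] --> (0 : R).
Proof.
move=> H.
have S : \sum_i (x k - xl) 0 i ^+ 2 @[k --> \oo] --> (0 : R).
  rewrite [X in _ --> X](_ : 0 = \sum_(i < n) (xl 0 i - xl 0 i) ^+ 2);
    last first.
    by rewrite big1// => i _; rewrite subrr expr0n.
  apply: cvg_big => [|i _]; first exact: add_continuous.
  under eq_fun do rewrite !mxE expr2.
  have B : x k 0 i - xl 0 i @[k --> \oo] --> xl 0 i - xl 0 i.
    by apply: cvgB; [exact: cvg_coord|exact: cvg_cst].
  by rewrite expr2; exact: cvgM.
rewrite -[X in _ --> X]sqrtr0.
exact: (continuous_cvg _ (@sqrt_continuous R 0) S).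
Qed.

Lemma cvg_gradient (f : 'rV[R]_n -> R) L (x : nat -> 'rV[R]_n) xl i :
  lipschitz_gradient f L -> x k @[k --> \oo] --> xl ->
  gradient f (x k) 0 i @[k --> \oo] --> gradient f xl 0 i.
Proof.
move=> [_ fL] H.
have H0 : L * norm2 (x k - xl) @[k --> \oo] --> 0.
  rewrite -[X in _ --> X](mulr0 L).
  by apply: cvgM; [exact: cvg_cst|exact: norm2_cvg0].
apply/cvgrPdist_le => e e0.
move/cvgrPdist_le: H0 => /(_ e e0); apply: filterS => k.
rewrite sub0r normrN => He.
rewrite distrC; apply: le_trans He; apply: le_trans (ler_norm _).
apply: le_trans (fL _ _).
by apply: le_trans (coord_le_norm2 _ i); rewrite !mxE.
Qed.

Lemma box_coord_closed (l u : 'I_n -> \bar R) i (a : nat -> R) al :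
  (forall k, box_coord l u i (a k)) -> a k @[k --> \oo] --> al ->
  box_coord l u i al.
Proof.
rewrite /box_coord/= => aB H; apply/andP; split.
- case: (l i) aB => [r| |] aB; rewrite ?leNye//.
    rewrite lee_fin; apply: (cvgr_to_ge H); apply: nearW => k.
    by have /andP[] := aB k; rewrite !lee_fin.
  by have /andP[] := aB 0%N.
- case: (u i) aB => [r| |] aB; rewrite ?leey//.
    rewrite lee_fin; apply: (cvgr_to_le H); apply: nearW => k.
    by have /andP[] := aB k; rewrite !lee_fin.
  by have /andP[] := aB 0%N.
Qed.

End Limits.

(** * Convergence of the iterates and optimality of the limit *)

Section Sequence.
Context {R : realType} {n : nat}.
Context (f : 'rV[R]_n -> R) (Lf lambda1 lambda2 : R) (l u : 'I_n -> \bar R).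
Context (eps beta h gamma : R) (x : nat -> 'rV[R]_n).
Context (lambda1_gt0 : 0 < lambda1) (lambda2_ge0 : 0 <= lambda2)
  (f_lipschitz : lipschitz_gradient f Lf)
  (eps_gt0 : 0 < eps) (beta_ge0 : 0 <= beta) (h_gt0 : 0 < h)
  (gamma_gt0 : 0 < gamma)
  (x_eht : eht_sequence f lambda1 lambda2 l u eps beta h gamma x).

Let y k := h^-1 *: (x k.+1 - x k).

Lemma eht_step k : x k.+1 = x k + h *: y k.
Proof. by rewrite /y scalerA divff ?gt_eqF// scale1r addrC subrK. Qed.

Lemma eht_step_argmin k : argmin_on (step_box l u h (x k))
  (eht_Q lambda1 lambda2 eps h gamma (x k)
     (eht_z f beta h gamma (x k.-1) (x k))) (y k).
Proof.
have [y' y'min] := x_eht.2 k; rewrite /y => <-.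
by rewrite addrAC subrr add0r scalerA mulVf ?gt_eqF// scale1r.
Qed.

Lemma eht_box k : box l u (x k).
Proof.
case: k => [|k]; first exact: x_eht.1.
by rewrite eht_step; apply/step_boxE => //; exact: (eht_step_argmin k).1.
Qed.

Lemma eht_cvg :
  1 / h + (2 * beta + h) * Lf <= gamma ->
  bounded_below_on (box l u) (objective f lambda1 lambda2) ->
  exists xinf : 'rV[R]_n, x k @[k --> \oo] --> xinf.
Proof.
move=> gamma_ge [m Fm].
pose a := 1 / (2 * h ^+ 2) + beta * Lf / (2 * h).
pose E k := objective f lambda1 lambda2 (x k) + a * norm2 (x k - x k.-1) ^+ 2.
have Edec k i : `|x k.+1 0 i - x k 0 i| <= E k / eps - E k.+1 / eps.
  rewrite -mulrBl ler_pdivlMr// mulrC.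
  have dx : h *: y k = x k.+1 - x k by rewrite eht_step addrAC subrr add0r.
  have := lyapunov_decrease _ _ _ _ _ _ _ _ _ _ _ _ _ f_lipschitz
    beta_ge0 h_gt0 gamma_gt0 gamma_ge (eht_box k) (eht_step_argmin k).
  rewrite -eht_step dx -/a => H.
  have := coord_le_norm1 (x k.+1 - x k) i; rewrite !mxE.
  rewrite -(ler_pM2l eps_gt0); rewrite /E/=; lra.
have Elb k : m / eps <= E k / eps.
  rewrite ler_pM2r ?invr_gt0//.
  have Fk : m <= objective f lambda1 lambda2 (x k).
    by apply: Fm; exists (x k) => //; exact: eht_box.
  apply: (le_trans Fk); rewrite lerDl /a mulrDl addr_ge0//.
    by rewrite mulr_ge0 ?divr_ge0 ?sqr_ge0// mulr_ge0// sqr_ge0.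
  move: (x k - x k.-1) => d.
  rewrite (_ : _ * norm2 d ^+ 2 =
    beta / (2 * h) * norm2 d * (Lf * norm2 d)); last first.
    by field; rewrite gt_eqF.
  apply: mulr_ge0; last exact: lipschitz_norm_ge0 f_lipschitz.
  apply: mulr_ge0; last exact: norm2_ge0.
  by rewrite divr_ge0// mulr_ge0// ltW.
have xcvg i : cvgn (fun k => x k 0 i).
  exact: (cvgn_increments _ _ _ (Edec^~ i) Elb).
exists (\row_i limn (fun k => x k 0 i)).
by apply: cvg_row => i; rewrite mxE; exact: xcvg.
Qed.

(** Passing to the limit in [argmin_variational]: the steps and the gradient
    increments vanish, so only the gradient at the limit survives in the slope.
    The threshold [s0] is allowed to shrink along the sequence. *)
Lemma eht_limit_variational (xinf : 'rV[R]_n) i t :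
  x k @[k --> \oo] --> xinf -> box_coord l u i t ->
  (\forall k \near \oo, exists2 s0 : R, 0 < s0 <= 1 &
    forall s, 0 < s <= s0 ->
      let w := x k.+2 0 i + s * (t - x k.+2 0 i) in
      (0 < w -> 0 < x k.+2 0 i) /\ (0 < lambda2 -> w < 0 -> x k.+2 0 i < 0)) ->
  0 <= eps * `|t - xinf 0 i| + gradient f xinf 0 i * (t - xinf 0 i).
Proof.
move=> xcvg tB signs.
set g := fun k => gradient f (x k) 0 i.
(* The slope of the smooth part of [eht_Q] at the new point, in the scaling of
   [argmin_variational]; all its terms but the last one vanish in the limit. *)
pose r k := (1 + h * gamma) / h * (x k.+2 0 i - x k.+1 0 i) / h
  - 1 / h * (1 / h * (x k.+1 0 i - x k 0 i))
  + beta / h * (g k.+1 - g k) + g k.+1.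
have rE k : (1 + h * gamma) / h * (y k.+1 0 i -
    eht_z f beta h gamma (x k) (x k.+1) 0 i) = r k.
  rewrite /r /g /eht_z /eht_v /y !mxE; field.
  by rewrite !gt_eqF// addr_gt0// mulr_gt0.
have c0 : x k 0 i @[k --> \oo] --> xinf 0 i by exact: cvg_coord.
have c1 : x k.+1 0 i @[k --> \oo] --> xinf 0 i.
  by rewrite (cvg_shiftS (fun k => x k 0 i)).
have c2 : x k.+2 0 i @[k --> \oo] --> xinf 0 i.
  by rewrite (cvg_shiftS (fun k => x k.+1 0 i)).
have g0 : g k @[k --> \oo] --> gradient f xinf 0 i.
  exact: cvg_gradient f_lipschitz xcvg.
have g1 : g k.+1 @[k --> \oo] --> gradient f xinf 0 i.
  by rewrite (cvg_shiftS g).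
set G := gradient f xinf 0 i in g0 g1 *.
have rG : r k @[k --> \oo] --> G.
  rewrite (_ : G = (1 + h * gamma) / h * (xinf 0 i - xinf 0 i) / h
    - 1 / h * (1 / h * (xinf 0 i - xinf 0 i)) + beta / h * (G - G) + G).
    apply: cvgD => //; apply: cvgD; first apply: cvgB.
    - apply: cvgM; last exact: cvg_cst.
      by apply: cvgM; [exact: cvg_cst|exact: cvgB].
    - apply: cvgM; first exact: cvg_cst.
      by apply: cvgM; [exact: cvg_cst|exact: cvgB].
    - by apply: cvgM; [exact: cvg_cst|exact: cvgB].
  by rewrite !subrr !(mulr0, mul0r) subrr !add0r.
have lim : eps * `|t - x k.+2 0 i| + r k * (t - x k.+2 0 i) @[k --> \oo] -->
    eps * `|t - xinf 0 i| + G * (t - xinf 0 i).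
  have ct : t - x k.+2 0 i @[k --> \oo] --> t - xinf 0 i.
    by apply: cvgB => //; exact: cvg_cst.
  apply: cvgD; last exact: cvgM.
  by apply: cvgM; [exact: cvg_cst|exact: cvg_norm].
apply: (cvgr_to_ge lim); apply: filterS signs => k [s0 s01 H].
rewrite -rE eht_step.
apply: (@argmin_variational _ _ l u lambda1 lambda2 _ _ _ _ s0) => //;
  try exact: ltW.
- exact: (eht_step_argmin k.+1).
- by move=> s ss; rewrite -eht_step => w0; exact: (H s ss).1.
- by move=> s ss; rewrite -eht_step => l0 w0; exact: (H s ss).2.
Qed.

End Sequence.

Theorem theorem4p2 (R : realType) (n : nat) (f : 'rV[R]_n -> R)
    (Lf lambda1 lambda2 : R) (l u : 'I_n -> \bar R)
    (eps beta h gamma : R) (x : nat -> 'rV[R]_n)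
    (lambda1_gt0 : 0 < lambda1) (lambda2_ge0 : 0 <= lambda2)
    (f_convex : convex_function setT f)
    (f_lipschitz : lipschitz_gradient f Lf)
    (lu_0 : forall i, (l i <= 0 <= u i)%E)
    (l_lt_u : forall i, (l i < u i)%E)
    (F_bounded : bounded_below_on (box l u) (objective f lambda1 lambda2))
    (eps_gt0 : 0 < eps) (beta_ge0 : 0 <= beta) (h_gt0 : 0 < h)
    (gamma_gt0 : 0 < gamma)
    (gamma_ge : 1 / h + (2 * beta + h) * Lf <= gamma)
    (x_eht : eht_sequence f lambda1 lambda2 l u eps beta h gamma x) :
  exists xinf : 'rV[R]_n,
    [/\ box l u xinf,
        x k @[k --> \oo] --> xinf
      & eps_local_minimizer f lambda2 l u eps xinf].
Proof.
have [xinf xcvg] : exists xinf : 'rV[R]_n, x k @[k --> \oo] --> xinf.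
  exact: eht_cvg x_eht gamma_ge F_bounded.
have xinfB : box l u xinf.
  move=> i; apply: box_coord_closed (cvg_coord _ _ i xcvg) => k.
  exact: eht_box x_eht k i.
have c2 i : x k.+2 0 i @[k --> \oo] --> xinf 0 i.
  have := cvg_coord _ _ i xcvg.
  by rewrite -cvg_shiftS -cvg_shiftS.
have support i : xinf 0 i != 0 ->
    eps_stationary eps (gradient f xinf 0 i) (box_coord l u i) (xinf 0 i).
  move=> xi0; apply: eps_stationaryP; first exact: ltW.
  move=> t tB; apply: (@eht_limit_variational R n f Lf lambda1 lambda2 l u
    eps beta h gamma x) => //.
  apply: filterS (cvgr_neq0 _ (c2 i) xi0) => k xk0.
  have [s0 s01 Hs0] := small_step_keeps_sign _ t xk0.
  exists s0 => // s ss; have [? ?] := Hs0 s ss; by split.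
exists xinf; split=> //; split=> // l20 i [xi0|[xi0 li0]].
  by rewrite /sbox_coord xi0; exact: support.
have -> : sbox_coord l u xinf i = [set t | (l i <= t%:E <= 0)%E].
  by rewrite /sbox_coord xi0 eqxx.
apply: eps_stationaryP => [|t /andP[lt t0]]; first exact: ltW.
apply: (@eht_limit_variational R n f Lf lambda1 lambda2 l u
  eps beta h gamma x) => //.
  rewrite /box_coord/= lt/=; apply: le_trans t0 _.
  by have /andP[] := lu_0 i.
(* A move towards the nonpositive [t] cannot create a positive coordinate,
   and negative coordinates are not penalized. *)
apply: nearW => k; exists 1; first by rewrite ltr01 lexx.
move=> s /andP[s0 s1] /=; rewrite l20 ltxx; split=> // w0.
rewrite ltNge; apply/negP => xk0; move: t0 w0; rewrite lee_fin; nra.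
Qed.
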